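(* Every s-hypersequent $\alpha_1\vdash\beta_1\mid\dots\mid\alpha_n\vdash\beta_n$ that is valid in the class of all pure double Boolean algebras is provable in the logic $\mathbf{PDBL}$.
   Context: Pure double Boolean algebras. A double Boolean algebra (dBa) is an algebra $\mathbf{D}=(D,\sqcup,\sqcap,\neg,\lrcorner,\top,\bot)$ (binary $\sqcup,\sqcap$, unary $\neg,\lrcorner$, constants $\top,\bot$) such that, writing $x\vee y:=\neg(\neg x\sqcap\neg y)$ and $x\wedge y:=\lrcorner(\lrcorner x\sqcup\lrcorner y)$, for all $x,y,z\in D$: $(x\sqcap x)\sqcap y=x\sqcap y$; $(x\sqcup x)\sqcup y=x\sqcup y$; $\sqcap$ and $\sqcup$ are commutative and associative; $\neg(x\sqcap x)=\neg x$; $\lrcorner(x\sqcup x)=\lrcorner x$; $x\sqcap(x\sqcup y)=x\sqcap x$; $x\sqcup(x\sqcap y)=x\sqcup x$; $x\sqcap(y\vee z)=(x\sqcap y)\vee(x\sqcap z)$; $x\sqcup(y\wedge z)=(x\sqcup y)\wedge(x\sqcup z)$; $x\sqcap(x\vee y)=x\sqcap x$; $x\sqcup(x\wedge y)=x\sqcup x$; $\neg\neg(x\sqcap y)=x\sqcap y$; $\lrcorner\lrcorner(x\sqcup y)=x\sqcup y$; $x\sqcap\neg x=\bot$; $x\sqcup\lrcorner x=\top$; $\neg\bot=\top\sqcap\top$; $\lrcorner\top=\bot\sqcup\bot$; $\neg\top=\bot$; $\lrcorner\bot=\top$; $(x\sqcap x)\sqcup(x\sqcap x)=(x\sqcup x)\sqcap(x\sqcup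 x)$. It is pure (a pdBa) if for every $x\in D$, $x\sqcap x=x$ or $x\sqcup x=x$. Put $D_\sqcap=\{x:x\sqcap x=x\}$, $D_\sqcup=\{x:x\sqcup x=x\}$, and $x\sqsubseteq y$ iff $x\sqcap y=x\sqcap x$ and $x\sqcup y=y\sqcup y$. The logic PDBL. The language has two disjoint countably infinite sets of variables, object variables $\mathbf{OV}$ ($p,q,\dots$) and property variables $\mathbf{PV}$ ($P,Q,\dots$), constants $\top,\bot$, binary connectives $\sqcap,\sqcup$ and unary connectives $\neg,\lrcorner$; formulae: $\top\mid\bot\mid p\mid P\mid\alpha\sqcup\beta\mid\alpha\sqcap\beta\mid\neg\alpha\mid\lrcorner\alpha$. Abbreviations: $\alpha\vee\beta:=\neg(\neg\alpha\sqcap\neg\beta)$, $\alpha\wedge\beta:=\lrcorner(\lrcorner\alpha\sqcup\lrcorner\beta)$. A sequent is a pair of formulae written $\alpha\vdash\beta$; $\alpha\dashv\vdash\beta$ abbreviates the two sequents $\alpha\vdash\beta$, $\beta\vdash\alpha$. An s-hypersequent is a finite sequence $\alpha_1\vdash\beta_1\mid\dots\mid\alpha_n\vdash\beta_n$ of sequents (its components); $B,C,D,E,F,G,H,X$ range over possibly empty s-hypersequents. Axioms (for all formulae $\alpha,\beta,\gamma$, $p\in\mathbf{OV}$, $P\in\mathbf{PV}$): $\alpha\vdash\alpha$; $\alpha\sqcap\beta\vdash\alpha$; $\alpha\sqcap\beta\vdash\beta$; $\alpha\vdash\alpha\sqcup\beta$; $\beta\vdash\alpha\sqcup\beta$; $\alpha\sqcap\beta\vdash(\alpha\sqcap\beta)\sqcap(\alpha\sqcap\beta)$;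 $(\alpha\sqcup\beta)\sqcup(\alpha\sqcup\beta)\vdash\alpha\sqcup\beta$; $\neg(\alpha\sqcap\alpha)\vdash\neg\alpha$; $\lrcorner\alpha\vdash\lrcorner(\alpha\sqcup\alpha)$; $\alpha\sqcap\neg\alpha\vdash\bot$; $\top\vdash\alpha\sqcup\lrcorner\alpha$; $\neg\neg(\alpha\sqcap\beta)\dashv\vdash\alpha\sqcap\beta$; $\lrcorner\lrcorner(\alpha\sqcup\beta)\dashv\vdash\alpha\sqcup\beta$; $\alpha\sqcap\alpha\vdash\alpha\sqcap(\alpha\sqcup\beta)$; $\alpha\sqcup(\alpha\sqcap\beta)\vdash\alpha\sqcup\alpha$; $\alpha\sqcap\alpha\vdash\alpha\sqcap(\alpha\vee\beta)$; $\alpha\sqcup(\alpha\wedge\beta)\vdash\alpha\sqcup\alpha$; $\alpha\sqcap(\beta\vee\gamma)\dashv\vdash(\alpha\sqcap\beta)\vee(\alpha\sqcap\gamma)$; $\alpha\sqcup(\beta\wedge\gamma)\dashv\vdash(\alpha\sqcup\beta)\wedge(\alpha\sqcup\gamma)$; $\bot\vdash\alpha$; $\alpha\vdash\top$; $\neg\top\vdash\bot$; $\top\vdash\lrcorner\bot$; $\neg\bot\dashv\vdash\top\sqcap\top$; $\lrcorner\top\dashv\vdash\bot\sqcup\bot$; $(\alpha\sqcup\alpha)\sqcap(\alpha\sqcup\alpha)\dashv\vdash(\alpha\sqcap\alpha)\sqcup(\alpha\sqcap\alpha)$; $p\sqcap p\dashv\vdash p$; $P\sqcup P\dashv\vdash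 P$; and (Sp) the s-hypersequent $\alpha\vdash\alpha\sqcap\alpha\mid\alpha\sqcup\alpha\vdash\alpha$. Rules: from $B\mid\alpha\vdash\beta\mid C$ infer each of $B\mid\alpha\sqcap\gamma\vdash\beta\sqcap\gamma\mid C$, $B\mid\gamma\sqcap\alpha\vdash\gamma\sqcap\beta\mid C$, $B\mid\alpha\sqcup\gamma\vdash\beta\sqcup\gamma\mid C$, $B\mid\gamma\sqcup\alpha\vdash\gamma\sqcup\beta\mid C$, $B\mid\neg\beta\vdash\neg\alpha\mid C$, $B\mid\lrcorner\beta\vdash\lrcorner\alpha\mid C$; from $B\mid\alpha\vdash\beta\mid C$ and $D\mid\beta\vdash\gamma\mid E$ infer $B\mid D\mid\alpha\vdash\gamma\mid C\mid E$; from $B\mid\alpha\sqcap\beta\vdash\alpha\sqcap\alpha\mid C$, $D\mid\alpha\sqcap\alpha\vdash\alpha\sqcap\beta\mid E$, $F\mid\alpha\sqcup\beta\vdash\beta\sqcup\beta\mid G$, $H\mid\beta\sqcup\beta\vdash\alpha\sqcup\beta\mid X$ infer $B\mid D\mid F\mid H\mid\alpha\vdash\beta\mid C\mid E\mid G\mid X$; external rules: from $B\mid D\mid D\mid C$ infer $B\mid D\mid C$; from $B\mid D\mid E\mid C$ infer $B\mid E\mid D\mid C$; from $B$ infer $B\mid C$. An s-hypersequent is provable if it is the last member of a finite sequence each member of which is an axiom or follows from earlier members by a rule. Algebraic semantics. A valuation on a pdBa $\mathbf{D}$ is a map $v$ on $\mathbf{OV}\cup\mathbf{PV}\cup\{\top,\bot\}$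 with $v(p)\in D_\sqcap$ for $p\in\mathbf{OV}$, $v(P)\in D_\sqcup$ for $P\in\mathbf{PV}$, $v(\top)=\top$, $v(\bot)=\bot$, extended to all formulae homomorphically. $v$ satisfies $\alpha\vdash\beta$ iff $v(\alpha)\sqsubseteq v(\beta)$, and satisfies an s-hypersequent iff it satisfies one of its components. An s-hypersequent is true in $\mathbf{D}$ if every valuation on $\mathbf{D}$ satisfies it, and valid in the class of pdBas if true in every pdBa. *)

(* Defs.v *)
From Stdlib Require Import List.
Import ListNotations.

Set Implicit Arguments.

Reserved Notation "x ⊓ y" (at level 40, left associativity).
Reserved Notation "x ⊔ y" (at level 50, left associativity).
Reserved Notation "x ∧ y" (at level 40, left associativity).
Reserved Notation "x ∨ y" (at level 50, left associativity).
Reserved Notation "¬ x" (at level 35, right associativity).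
Reserved Notation "⌟ x" (at level 35, right associativity).
Reserved Notation "x ⊑ y" (at level 70, no associativity).
Reserved Notation "a ⊢ b" (at level 70, no associativity).

Declare Scope dba_scope.
Delimit Scope dba_scope with dba.
Declare Scope form_scope.
Delimit Scope form_scope with form.

(** * Pure double Boolean algebras *)

Record dba_alg : Type := DbaAlg {
  carrier :> Type;
  join : carrier -> carrier -> carrier;
  meet : carrier -> carrier -> carrier;
  neg : carrier -> carrier;
  opp : carrier -> carrier;
  top : carrier;
  bot : carrier
}.

Arguments join {_} _ _.
Arguments meet {_} _ _.
Arguments neg {_} _.
Arguments opp {_} _.
Arguments top {_}.
Arguments bot {_}.

Notation "x ⊔ y" := (join x y) : dba_scope.
Notation "x ⊓ y" := (meet x y) : dba_scope.
Notation "¬ x" := (neg x) : dba_scope.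
Notation "⌟ x" := (opp x) : dba_scope.
Notation "⊤" := top : dba_scope.
Notation "⊥" := bot : dba_scope.

Definition vee {D : dba_alg} (x y : D) : D := (¬ (¬ x ⊓ ¬ y))%dba.
Definition wedge {D : dba_alg} (x y : D) : D := (⌟ (⌟ x ⊔ ⌟ y))%dba.

Notation "x ∨ y" := (vee x y) : dba_scope.
Notation "x ∧ y" := (wedge x y) : dba_scope.

Record is_dba (D : dba_alg) : Prop := {
  dba_meet_idl : forall x y : D, ((x ⊓ x) ⊓ y = x ⊓ y)%dba;
  dba_join_idl : forall x y : D, ((x ⊔ x) ⊔ y = x ⊔ y)%dba;
  dba_meetC : forall x y : D, (x ⊓ y = y ⊓ x)%dba;
  dba_joinC : forall x y : D, (x ⊔ y = y ⊔ x)%dba;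
  dba_meetA : forall x y z : D, (x ⊓ (y ⊓ z) = (x ⊓ y) ⊓ z)%dba;
  dba_joinA : forall x y z : D, (x ⊔ (y ⊔ z) = (x ⊔ y) ⊔ z)%dba;
  dba_neg_meet : forall x : D, (¬ (x ⊓ x) = ¬ x)%dba;
  dba_opp_join : forall x : D, (⌟ (x ⊔ x) = ⌟ x)%dba;
  dba_meet_join : forall x y : D, (x ⊓ (x ⊔ y) = x ⊓ x)%dba;
  dba_join_meet : forall x y : D, (x ⊔ (x ⊓ y) = x ⊔ x)%dba;
  dba_meet_vee_distr : forall x y z : D, (x ⊓ (y ∨ z) = (x ⊓ y) ∨ (x ⊓ z))%dba;
  dba_join_wedge_distr : forall x y z : D, (x ⊔ (y ∧ z) = (x ⊔ y) ∧ (x ⊔ z))%dba;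
  dba_meet_vee : forall x y : D, (x ⊓ (x ∨ y) = x ⊓ x)%dba;
  dba_join_wedge : forall x y : D, (x ⊔ (x ∧ y) = x ⊔ x)%dba;
  dba_negneg : forall x y : D, (¬ ¬ (x ⊓ y) = x ⊓ y)%dba;
  dba_oppopp : forall x y : D, (⌟ ⌟ (x ⊔ y) = x ⊔ y)%dba;
  dba_meet_neg : forall x : D, (x ⊓ ¬ x = ⊥)%dba;
  dba_join_opp : forall x : D, (x ⊔ ⌟ x = ⊤)%dba;
  dba_neg_bot : ((¬ ⊥ : D) = ⊤ ⊓ ⊤)%dba;
  dba_opp_top : ((⌟ ⊤ : D) = ⊥ ⊔ ⊥)%dba;
  dba_neg_top : ((¬ ⊤ : D) = ⊥)%dba;
  dba_opp_bot : ((⌟ ⊥ : D) = ⊤)%dba;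
  dba_idem : forall x : D, ((x ⊓ x) ⊔ (x ⊓ x) = (x ⊔ x) ⊓ (x ⊔ x))%dba
}.

Definition meet_idem {D : dba_alg} (x : D) : Prop := (x ⊓ x = x)%dba.
Definition join_idem {D : dba_alg} (x : D) : Prop := (x ⊔ x = x)%dba.

Definition is_pure (D : dba_alg) : Prop :=
  forall x : D, meet_idem x \/ join_idem x.

Definition is_pdba (D : dba_alg) : Prop := is_dba D /\ is_pure D.

Definition sqle {D : dba_alg} (x y : D) : Prop :=
  (x ⊓ y = x ⊓ x)%dba /\ (x ⊔ y = y ⊔ y)%dba.

Notation "x ⊑ y" := (sqle x y) : dba_scope.

(** * Syntax *)

Inductive formula : Type :=
| FTop
| FBot
| OV (p : nat)
| PV (P : nat)
| FJoin (a b : formula)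
| FMeet (a b : formula)
| FNeg (a : formula)
| FOpp (a : formula).

Notation "a ⊔ b" := (FJoin a b) : form_scope.
Notation "a ⊓ b" := (FMeet a b) : form_scope.
Notation "¬ a" := (FNeg a) : form_scope.
Notation "⌟ a" := (FOpp a) : form_scope.
Notation "⊤" := FTop : form_scope.
Notation "⊥" := FBot : form_scope.

Definition FVee (a b : formula) : formula := (¬ (¬ a ⊓ ¬ b))%form.
Definition FWedge (a b : formula) : formula := (⌟ (⌟ a ⊔ ⌟ b))%form.

Notation "a ∨ b" := (FVee a b) : form_scope.
Notation "a ∧ b" := (FWedge a b) : form_scope.

Record sequent : Type := Sequent { lhs : formula; rhs : formula }.

Notation "a ⊢ b" := (Sequent a%form b%form) : form_scope.

(** The components of an s-hypersequent are separated by [++] and [::]. *)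
Definition hypersequent : Type := list sequent.

(** * The calculus *)

Section Calculus.
Local Open Scope form_scope.
Local Open Scope list_scope.

Inductive seq_axiom : sequent -> Prop :=
| Ax_id a : seq_axiom (a ⊢ a)
| Ax_meetl a b : seq_axiom (a ⊓ b ⊢ a)
| Ax_meetr a b : seq_axiom (a ⊓ b ⊢ b)
| Ax_joinl a b : seq_axiom (a ⊢ a ⊔ b)
| Ax_joinr a b : seq_axiom (b ⊢ a ⊔ b)
| Ax_meet_idem a b : seq_axiom (a ⊓ b ⊢ (a ⊓ b) ⊓ (a ⊓ b))
| Ax_join_idem a b : seq_axiom ((a ⊔ b) ⊔ (a ⊔ b) ⊢ a ⊔ b)
| Ax_neg_meet a : seq_axiom (¬ (a ⊓ a) ⊢ ¬ a)
| Ax_opp_join a : seq_axiom (⌟ a ⊢ ⌟ (a ⊔ a))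
| Ax_meet_neg a : seq_axiom (a ⊓ ¬ a ⊢ ⊥)
| Ax_join_opp a : seq_axiom (⊤ ⊢ a ⊔ ⌟ a)
| Ax_negneg1 a b : seq_axiom (¬ ¬ (a ⊓ b) ⊢ a ⊓ b)
| Ax_negneg2 a b : seq_axiom (a ⊓ b ⊢ ¬ ¬ (a ⊓ b))
| Ax_oppopp1 a b : seq_axiom (⌟ ⌟ (a ⊔ b) ⊢ a ⊔ b)
| Ax_oppopp2 a b : seq_axiom (a ⊔ b ⊢ ⌟ ⌟ (a ⊔ b))
| Ax_meet_join a b : seq_axiom (a ⊓ a ⊢ a ⊓ (a ⊔ b))
| Ax_join_meet a b : seq_axiom (a ⊔ (a ⊓ b) ⊢ a ⊔ a)
| Ax_meet_vee a b : seq_axiom (a ⊓ a ⊢ a ⊓ (a ∨ b))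
| Ax_join_wedge a b : seq_axiom (a ⊔ (a ∧ b) ⊢ a ⊔ a)
| Ax_meet_vee_distr1 a b c : seq_axiom (a ⊓ (b ∨ c) ⊢ (a ⊓ b) ∨ (a ⊓ c))
| Ax_meet_vee_distr2 a b c : seq_axiom ((a ⊓ b) ∨ (a ⊓ c) ⊢ a ⊓ (b ∨ c))
| Ax_join_wedge_distr1 a b c : seq_axiom (a ⊔ (b ∧ c) ⊢ (a ⊔ b) ∧ (a ⊔ c))
| Ax_join_wedge_distr2 a b c : seq_axiom ((a ⊔ b) ∧ (a ⊔ c) ⊢ a ⊔ (b ∧ c))
| Ax_bot a : seq_axiom (⊥ ⊢ a)
| Ax_top a : seq_axiom (a ⊢ ⊤)
| Ax_neg_top : seq_axiom (¬ ⊤ ⊢ ⊥)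
| Ax_opp_bot : seq_axiom (⊤ ⊢ ⌟ ⊥)
| Ax_neg_bot1 : seq_axiom (¬ ⊥ ⊢ ⊤ ⊓ ⊤)
| Ax_neg_bot2 : seq_axiom (⊤ ⊓ ⊤ ⊢ ¬ ⊥)
| Ax_opp_top1 : seq_axiom (⌟ ⊤ ⊢ ⊥ ⊔ ⊥)
| Ax_opp_top2 : seq_axiom (⊥ ⊔ ⊥ ⊢ ⌟ ⊤)
| Ax_idem1 a : seq_axiom ((a ⊔ a) ⊓ (a ⊔ a) ⊢ (a ⊓ a) ⊔ (a ⊓ a))
| Ax_idem2 a : seq_axiom ((a ⊓ a) ⊔ (a ⊓ a) ⊢ (a ⊔ a) ⊓ (a ⊔ a))
| Ax_OV1 p : seq_axiom (OV p ⊓ OV p ⊢ OV p)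
| Ax_OV2 p : seq_axiom (OV p ⊢ OV p ⊓ OV p)
| Ax_PV1 P : seq_axiom (PV P ⊔ PV P ⊢ PV P)
| Ax_PV2 P : seq_axiom (PV P ⊢ PV P ⊔ PV P).

Inductive hyp_axiom : hypersequent -> Prop :=
| Ax_seq s : seq_axiom s -> hyp_axiom [s]
| Ax_Sp a : hyp_axiom [a ⊢ a ⊓ a; a ⊔ a ⊢ a].

(** [rule Hs H]: [H] follows from the list of premises [Hs]. *)
Inductive rule : list hypersequent -> hypersequent -> Prop :=
| R_meetl B C a b c :
    rule [B ++ [a ⊢ b] ++ C] (B ++ [a ⊓ c ⊢ b ⊓ c] ++ C)
| R_meetr B C a b c :
    rule [B ++ [a ⊢ b] ++ C] (B ++ [c ⊓ a ⊢ c ⊓ b] ++ C)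
| R_joinl B C a b c :
    rule [B ++ [a ⊢ b] ++ C] (B ++ [a ⊔ c ⊢ b ⊔ c] ++ C)
| R_joinr B C a b c :
    rule [B ++ [a ⊢ b] ++ C] (B ++ [c ⊔ a ⊢ c ⊔ b] ++ C)
| R_neg B C a b :
    rule [B ++ [a ⊢ b] ++ C] (B ++ [¬ b ⊢ ¬ a] ++ C)
| R_opp B C a b :
    rule [B ++ [a ⊢ b] ++ C] (B ++ [⌟ b ⊢ ⌟ a] ++ C)
| R_cut B C D E a b c :
    rule [B ++ [a ⊢ b] ++ C; D ++ [b ⊢ c] ++ E]
         (B ++ D ++ [a ⊢ c] ++ C ++ E)
| R_order B C D E F G H X a b :
    rule [B ++ [a ⊓ b ⊢ a ⊓ a] ++ C; D ++ [a ⊓ a ⊢ a ⊓ b] ++ E;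
          F ++ [a ⊔ b ⊢ b ⊔ b] ++ G; H ++ [b ⊔ b ⊢ a ⊔ b] ++ X]
         (B ++ D ++ F ++ H ++ [a ⊢ b] ++ C ++ E ++ G ++ X)
| R_contr B C D :
    rule [B ++ D ++ D ++ C] (B ++ D ++ C)
| R_exch B C D E :
    rule [B ++ D ++ E ++ C] (B ++ E ++ D ++ C)
| R_weak B C :
    rule [B] (B ++ C).

Definition derivation (d : list hypersequent) : Prop :=
  forall d1 H d2, d = d1 ++ H :: d2 ->
    hyp_axiom H \/ exists Hs, rule Hs H /\ incl Hs d1.

Definition provable (H : hypersequent) : Prop :=
  exists d, derivation (d ++ [H]).

End Calculus.

(** * Algebraic semantics *)

(** The values at the constants are forced, so only the values at the
    variables are recorded; [eval] supplies the constants. *)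
Record valuation (D : dba_alg) : Type := Valuation {
  val_OV : nat -> D;
  val_PV : nat -> D;
  val_OV_meet_idem : forall p, meet_idem (val_OV p);
  val_PV_join_idem : forall P, join_idem (val_PV P)
}.

Fixpoint eval (D : dba_alg) (v : valuation D) (a : formula) : D :=
  match a with
  | FTop => top
  | FBot => bot
  | OV p => val_OV v p
  | PV P => val_PV v P
  | FJoin a b => join (eval v a) (eval v b)
  | FMeet a b => meet (eval v a) (eval v b)
  | FNeg a => neg (eval v a)
  | FOpp a => opp (eval v a)
  end.

Definition sat_seq (D : dba_alg) (v : valuation D) (s : sequent) : Prop :=
  (eval v (lhs s) ⊑ eval v (rhs s))%dba.

Definition sat (D : dba_alg) (v : valuation D) (H : hypersequent) : Prop :=
  exists s, In s H /\ sat_seq v s.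

Definition true_in (D : dba_alg) (H : hypersequent) : Prop :=
  forall v : valuation D, sat v H.

Definition valid (H : hypersequent) : Prop :=
  forall D : dba_alg, is_pdba D -> true_in D H.

(* Main.v *)
(** If [H] is not provable, Zorn's lemma yields a maximal set [T] of sequents
    that contains the components of [H] and no finite sequence of members of
    which is provable.  Call [s] a consequence when [s | L] is provable for some
    finite [L] in [T].  Under this reading the calculus loses its
    hypersequent contexts: "consequence" is closed under the context-free rules,
    while maximality of [T] makes one of the two components of each instance of
    (Sp) a consequence.  Hence the Lindenbaum algebra of the preorder
    "[a ⊢ b] is a consequence" is a pure double Boolean algebra, in which the
    canonical valuation satisfies only consequences, and no component of [H] is
    one. *)

From Stdlib Require Import List Permutation Classical ClassicalEpsilon.
From Stdlib Require Import ProofIrrelevance FunctionalExtensionality PropExtensionality.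
From mathcomp Require classical_sets.
Require Import Defs.
Import ListNotations.

(** * Provability *)

(** A step may use any earlier member, so the members of [d2] stay justified with [d1] in front.
    Derivations of several premises can thus be merged. *)
Lemma derivation_app d1 d2 :
  derivation d1 -> derivation d2 -> derivation (d1 ++ d2).
Proof.
intros h1 h2 e1 H e2 E.
assert (split : (exists r, d1 = e1 ++ H :: r) \/ exists r, e1 = d1 ++ r /\ d2 = r ++ H :: e2).
{ clear h1 h2; revert e1 E; induction d1 as [|x d1 IH]; intros e1 E.
  - right; exists e1; split; [reflexivity | exact E].
  - destruct e1 as [|y e1]; simpl in E; injection E as -> E.
    + left; exists d1; reflexivity.
    + destruct (IH _ E) as [[r ->] | [r [-> ->]]].
      * left; exists r; reflexivity.
      * right; exists r; split; reflexivity. }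
destruct split as [[r ->] | [r [-> ->]]].
- exact (h1 _ _ _ eq_refl).
- destruct (h2 _ _ _ eq_refl) as [ax | [Hs [R I]]]; [now left | right].
  exists Hs; split; [exact R | now apply incl_appr].
Qed.

Lemma derivation_rcons d H :
  derivation d -> hyp_axiom H \/ (exists Hs, rule Hs H /\ incl Hs d) ->
  derivation (d ++ [H]).
Proof.
intros hd hH e1 K e2 E.
destruct e2 as [|z e2 _] using rev_ind.
- apply app_inj_tail in E as [-> ->]; exact hH.
- replace (e1 ++ K :: e2 ++ [z]) with ((e1 ++ K :: e2) ++ [z]) in E
    by now rewrite <- app_assoc.
  apply app_inj_tail in E as [-> _]; exact (hd _ _ _ eq_refl).
Qed.

Lemma provable_axiom H : hyp_axiom H -> provable H.
Proof.
intro ax; exists []; apply derivation_rcons; [|now left].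
intros [|] ? ? E; discriminate E.
Qed.

Lemma provable_rule Hs H : rule Hs H -> Forall provable Hs -> provable H.
Proof.
intros R F.
assert (all : exists d, derivation d /\ incl Hs d).
{ clear R; induction F as [|K Hs [d1 h1] _ [d [h I]]].
  - exists []; split; [intros [|] ? ? E; discriminate E | apply incl_nil_l].
  - exists ((d1 ++ [K]) ++ d); split; [now apply derivation_app|].
    apply incl_cons; [|now apply incl_appr].
    apply in_or_app; left; apply in_or_app; right; now left. }
destruct all as [d [h I]].
exists d; apply derivation_rcons; [exact h | right; now exists Hs].
Qed.

Lemma provable_rule1 H1 H : rule [H1] H -> provable H1 -> provable H.
Proof. intros R h; apply (provable_rule [H1] H R); now constructor. Qed.

Lemma provable_perm L L' : Permutation L L' -> provable L -> provable L'.
Proof.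
intro p.
(* In the [perm_skip] case the common head moves into the prefix [B]. *)
enough (gen : forall B, provable (B ++ L) -> provable (B ++ L')) by exact (gen []).
induction p as [|x L L' _ IH|x y L|L1 L2 L3 _ IH1 _ IH2]; intro B.
- trivial.
- intro h; specialize (IH (B ++ [x])); rewrite <- !app_assoc in IH; exact (IH h).
- exact (provable_rule1 _ _ (R_exch B L [y] [x])).
- intro h; exact (IH2 _ (IH1 _ h)).
Qed.

(** Weakening appends [L']; each member of [L] then duplicates one of [L'] and is contracted away.
    So provability depends only on the set of components. *)
Lemma provable_incl L L' : incl L L' -> provable L -> provable L'.
Proof.
intros I h.
apply (provable_rule1 _ _ (R_weak L L')) in h.
induction L as [|x L IH]; [exact h|].
apply incl_cons_inv in I as [xL' I]; apply IH; [exact I|].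
destruct (in_split _ _ xL') as [l1 [l2 ->]].
apply (provable_perm ([] ++ [x] ++ (L ++ l1 ++ l2))).
{ simpl; rewrite !app_assoc; apply Permutation_middle. }
apply (provable_rule1 _ _ (R_contr [] (L ++ l1 ++ l2) [x])).
revert h; apply provable_perm; simpl; apply perm_skip.
symmetry; rewrite !app_assoc; apply Permutation_middle.
Qed.

(** * The Lindenbaum algebra of a pure order *)

(** The calculus without hypersequent contexts: rules become closure conditions, and [po_pure] is
    (Sp) with its bar read as a disjunction. *)
Record pure_order (le : formula -> formula -> Prop) : Prop := {
  po_axiom : forall a b, seq_axiom (Sequent a b) -> le a b;
  po_meetl : forall a b c, le a b -> le (FMeet a c) (FMeet b c);
  po_meetr : forall a b c, le a b -> le (FMeet c a) (FMeet c b);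
  po_joinl : forall a b c, le a b -> le (FJoin a c) (FJoin b c);
  po_joinr : forall a b c, le a b -> le (FJoin c a) (FJoin c b);
  po_neg : forall a b, le a b -> le (FNeg b) (FNeg a);
  po_opp : forall a b, le a b -> le (FOpp b) (FOpp a);
  po_trans : forall a b c, le a b -> le b c -> le a c;
  po_order : forall a b,
    le (FMeet a b) (FMeet a a) -> le (FMeet a a) (FMeet a b) ->
    le (FJoin a b) (FJoin b b) -> le (FJoin b b) (FJoin a b) -> le a b;
  po_pure : forall a, le a (FMeet a a) \/ le (FJoin a a) a
}.

Section Lindenbaum.
Variable le : formula -> formula -> Prop.
Hypothesis po : pure_order le.

Let eqv a b := le a b /\ le b a.

Local Ltac ax := apply (po_axiom _ po); constructor.

Lemma le_refl a : le a a.
Proof. ax. Qed.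

Lemma le_meet a b c d : le a c -> le b d -> le (FMeet a b) (FMeet c d).
Proof.
intros h k; apply (po_trans _ po) with (FMeet c b).
- now apply (po_meetl _ po).
- now apply (po_meetr _ po).
Qed.

Lemma le_join a b c d : le a c -> le b d -> le (FJoin a b) (FJoin c d).
Proof.
intros h k; apply (po_trans _ po) with (FJoin c b).
- now apply (po_joinl _ po).
- now apply (po_joinr _ po).
Qed.

(** A common lower bound [c] lies below [a ⊓ b] once [c ⊢ c ⊓ c], which the axioms grant to meets
    but not to all formulae; hence the shape of the left side. *)
Lemma meet_glb u v a b :
  le (FMeet u v) a -> le (FMeet u v) b -> le (FMeet u v) (FMeet a b).
Proof.
intros h k; apply (po_trans _ po) with (FMeet (FMeet u v) (FMeet u v)).
- ax.
- now apply le_meet.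
Qed.

Lemma join_lub u v a b :
  le a (FJoin u v) -> le b (FJoin u v) -> le (FJoin a b) (FJoin u v).
Proof.
intros h k; apply (po_trans _ po) with (FJoin (FJoin u v) (FJoin u v)).
- now apply le_join.
- ax.
Qed.

Lemma meet_lel a b c : le a c -> le (FMeet a b) c.
Proof. apply (po_trans _ po); ax. Qed.

Lemma meet_ler a b c : le b c -> le (FMeet a b) c.
Proof. apply (po_trans _ po); ax. Qed.

Lemma le_joinl a b c : le c a -> le c (FJoin a b).
Proof. intro h; apply (po_trans _ po) with a; [exact h | ax]. Qed.

Lemma le_joinr a b c : le c b -> le c (FJoin a b).
Proof. intro h; apply (po_trans _ po) with b; [exact h | ax]. Qed.

Lemma eqv_trans a b c : eqv a b -> eqv b c -> eqv a c.
Proof. intros [h h'] [k k']; split; eapply (po_trans _ po); eassumption. Qed.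

(** Equivalent formulae have the same predicate [eqv a], hence the same chosen representative. The
    quotient is the subtype of representatives, so that its equality is Leibniz equality, as
    [is_dba] asks. *)
Definition rep (a : formula) : formula := epsilon (inhabits FTop) (eqv a).

Lemma rep_eqv a : eqv a (rep a).
Proof.
apply (epsilon_spec (inhabits FTop) (eqv a)); exists a; split; apply le_refl.
Qed.

Lemma eqv_rep a b : eqv a b -> rep a = rep b.
Proof.
intro h; unfold rep; f_equal; extensionality c; apply propositional_extensionality.
split; apply eqv_trans; [split; apply h | exact h].
Qed.

Lemma rep_rep a : rep (rep a) = rep a.
Proof. symmetry; apply eqv_rep, rep_eqv. Qed.

Definition class : Type := {a : formula | rep a = a}.
Definition cl (a : formula) : class := exist _ (rep a) (rep_rep a).
Definition repr (x : class) : formula := proj1_sig x.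

Definition lindenbaum : dba_alg := {|
  carrier := class;
  join x y := cl (FJoin (repr x) (repr y));
  meet x y := cl (FMeet (repr x) (repr y));
  neg x := cl (FNeg (repr x));
  opp x := cl (FOpp (repr x));
  top := cl FTop;
  bot := cl FBot
|}.

Definition cls (a : formula) : lindenbaum := cl a.

Lemma cls_eq a b : le a b -> le b a -> cls a = cls b.
Proof.
intros h k; apply subset_eq_compat; apply eqv_rep; now split.
Qed.

Lemma cls_inj a b : cls a = cls b -> eqv a b.
Proof.
intro h; apply (f_equal repr) in h; simpl in h.
apply eqv_trans with (rep a); [apply rep_eqv|].
rewrite h; destruct (rep_eqv b); now split.
Qed.

Lemma cls_surj (x : lindenbaum) : exists a, x = cls a.
Proof.
destruct x as [a h]; exists a; apply subset_eq_compat; now symmetry.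
Qed.

Lemma cls_join a b : join (cls a) (cls b) = cls (FJoin a b).
Proof. apply cls_eq; apply le_join; apply rep_eqv. Qed.

Lemma cls_meet a b : meet (cls a) (cls b) = cls (FMeet a b).
Proof. apply cls_eq; apply le_meet; apply rep_eqv. Qed.

Lemma cls_neg a : neg (cls a) = cls (FNeg a).
Proof. apply cls_eq; apply (po_neg _ po); apply rep_eqv. Qed.

Lemma cls_opp a : opp (cls a) = cls (FOpp a).
Proof. apply cls_eq; apply (po_opp _ po); apply rep_eqv. Qed.

(** The invertible steps [meet_glb] and [join_lub] are taken eagerly; the choice of a component of a
    meet or join is searched with backtracking. *)
Local Ltac bound := repeat first
  [ apply le_refl | apply meet_glb | apply join_lub
  | solve [apply meet_lel; bound] | solve [apply meet_ler; bound]
  | solve [apply le_joinl; bound] | solve [apply le_joinr; bound]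
  | solve [ax] ].

Lemma lindenbaum_dba : is_dba lindenbaum.
Proof.
split;
  repeat match goal with
  | |- forall _ : carrier lindenbaum, _ =>
      let x := fresh "x" in intro x; destruct (cls_surj x) as [? ->]
  end;
  change (@top lindenbaum) with (cls FTop);
  change (@bot lindenbaum) with (cls FBot);
  unfold vee, wedge;
  repeat rewrite ?cls_meet, ?cls_join, ?cls_neg, ?cls_opp;
  apply cls_eq; try solve [ax].
(* Commutativity, associativity and the like follow from bounds; the missing halves of the laws for
   [¬ (x ⊓ x)] and [⌟ (x ⊔ x)] follow from antitonicity. *)
all: try solve [bound | apply (po_neg _ po); bound | apply (po_opp _ po); bound].
Qed.

Lemma lindenbaum_pdba : is_pdba lindenbaum.
Proof.
split; [exact lindenbaum_dba|].
intro x; destruct (cls_surj x) as [a ->]; unfold meet_idem, join_idem.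
rewrite cls_meet, cls_join.
destruct (po_pure _ po a) as [h|h]; [left | right]; apply cls_eq; try exact h; ax.
Qed.

(** * The canonical valuation *)

Lemma canonical_meet_idem p : meet_idem (cls (OV p)).
Proof. unfold meet_idem; rewrite cls_meet; apply cls_eq; ax. Qed.

Lemma canonical_join_idem P : join_idem (cls (PV P)).
Proof. unfold join_idem; rewrite cls_join; apply cls_eq; ax. Qed.

Definition canonical : valuation lindenbaum :=
  {| val_OV p := cls (OV p); val_PV P := cls (PV P);
     val_OV_meet_idem := canonical_meet_idem;
     val_PV_join_idem := canonical_join_idem |}.

Lemma eval_canonical a : eval canonical a = cls a.
Proof.
induction a as [| |p|P|a IHa b IHb|a IHa b IHb|a IHa|a IHa]; cbn -[lindenbaum];
  rewrite ?IHa, ?IHb; auto using cls_join, cls_meet, cls_neg, cls_opp.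
Qed.

(** The two equations that define [⊑] unfold to four inequalities, which are the premises of
    [po_order]. *)
Lemma sat_canonical s : sat_seq canonical s -> le (lhs s) (rhs s).
Proof.
destruct s as [a b]; unfold sat_seq, sqle; cbn [lhs rhs].
rewrite !eval_canonical, !cls_meet, !cls_join.
intros [hm hj]; apply cls_inj in hm, hj.
apply (po_order _ po); [apply hm | apply hm | apply hj | apply hj].
Qed.

End Lindenbaum.

Lemma valid_pure_order le H :
  pure_order le -> valid H -> exists s, In s H /\ le (lhs s) (rhs s).
Proof.
intros po h.
destruct (h _ (lindenbaum_pdba _ po) (canonical _ po)) as [s [sH hs]].
exists s; split; [exact sH | exact (sat_canonical _ po s hs)].
Qed.

(** * Consequences of a maximal refutable set *)

Definition refutable (T : sequent -> Prop) : Prop :=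
  forall L, (forall s, In s L -> T s) -> ~ provable L.

Definition consequence (T : sequent -> Prop) (s : sequent) : Prop :=
  exists L, (forall t, In t L -> T t) /\ provable (s :: L).

Lemma exists_maximal_refutable H :
  ~ provable H ->
  exists T : sequent -> Prop, (forall s, In s H -> T s) /\ refutable T /\
    forall s, consequence T s \/ T s.
Proof.
intro nH.
(* Zorn's lemma runs over [A], with the components of [H] added afterwards, so that the empty chain
   is covered by [nH]. *)
pose (add (A : sequent -> Prop) s := A s \/ In s H).
destruct (@classical_sets.Zorn_bigcup sequent (fun A => refutable (add A))) as [A [hA maxA]].
- intros F FP Fchain L LF hL.
  (* A finite [L] draws on [H] alone, or on [H] and a single member of the chain, since the larger
     of two members serves for both. *)
  assert (one : (forall s, In s L -> In s H) \/
                exists A, F A /\ forall s, In s L -> add A s).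
  { clear hL; induction L as [|x L IH]; [left; now intros|].
    destruct IH as [IH | [A [FA IH]]]; [intros s sL; apply LF; now right| |];
      (destruct (LF x (or_introl eq_refl)) as [[B FB xB] | xH]).
    - right; exists B; split; [exact FB|].
      intros s [<- | sL]; [now left | right; now apply IH].
    - left; intros s [<- | sL]; [exact xH | now apply IH].
    - destruct (Fchain _ _ FA FB) as [AB | BA]; right.
      + exists B; split; [exact FB|]; intros s [<- | sL]; [now left|].
        destruct (IH s sL) as [As | sH]; [left; now apply AB | now right].
      + exists A; split; [exact FA|]; intros s [<- | sL]; [left; now apply BA|].
        now apply IH.
    - right; exists A; split; [exact FA|].
      intros s [<- | sL]; [now right | now apply IH]. }
  destruct one as [LH | [B [FB LB]]].
  + apply nH; now apply (provable_incl L).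
  + exact (FP B FB L LB hL).
- exists (add A); split; [|split]; [intros s sH; now right | exact hA |].
  intro s; destruct (classic (add A s)) as [As | nAs]; [now right | left].
  (* Adjoining [s] properly enlarges the maximal [A], so some finite [L] becomes provable. *)
  assert (nB : ~ refutable (add (fun t => A t \/ t = s))).
  { apply maxA; split; [intros t At; now left|].
    intro BA; apply nAs; left; apply BA; now right. }
  apply not_all_ex_not in nB as [L nL].
  apply imply_to_and in nL as [LB hL]; apply NNPP in hL.
  (* The copies of [s] in [L] are merged into one head; [provable_incl] ignores order and
     multiplicity. *)
  assert (sep : exists L', (forall t, In t L' -> add A t) /\ incl L (s :: L')).
  { clear hL; induction L as [|x L IH].
    - exists []; split; [now intros | apply incl_nil_l].
    - destruct IH as [L' [L'A I]]; [intros t tL; apply LB; now right|].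
      destruct (LB x (or_introl eq_refl)) as [[xA | ->] | xH].
      + exists (x :: L'); split; [intros t [<- | tL]; [now left | now apply L'A]|].
        intros t [<- | tL]; [right; now left|].
        destruct (I t tL) as [<- | tL']; [now left | right; now right].
      + exists L'; split; [exact L'A|]; apply incl_cons; [now left | exact I].
      + exists (x :: L'); split; [intros t [<- | tL]; [now right | now apply L'A]|].
        intros t [<- | tL]; [right; now left|].
        destruct (I t tL) as [<- | tL']; [now left | right; now right]. }
  destruct sep as [L' [L'A I]]; exists L'; split; [exact L'A|].
  exact (provable_incl _ _ I hL).
Qed.

(** The witness [L] passes unchanged through the rule as its right context. *)
Lemma consequence_rule1 T s t :
  (forall C, rule [[s] ++ C] ([t] ++ C)) -> consequence T s -> consequence T t.
Proof.
intros R [L [LT h]]; exists L; split; [exact LT|].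
exact (provable_rule1 _ _ (R L) h).
Qed.

Lemma consequence_pure_order T :
  refutable T -> (forall s, consequence T s \/ T s) ->
  pure_order (fun a b => consequence T (Sequent a b)).
Proof.
intros Tref Tmax; split.
- intros a b h; exists []; split; [now intros|].
  now apply provable_axiom, Ax_seq.
- intros a b c; apply consequence_rule1; intro C; exact (R_meetl [] C a b c).
- intros a b c; apply consequence_rule1; intro C; exact (R_meetr [] C a b c).
- intros a b c; apply consequence_rule1; intro C; exact (R_joinl [] C a b c).
- intros a b c; apply consequence_rule1; intro C; exact (R_joinr [] C a b c).
- intros a b; apply consequence_rule1; intro C; exact (R_neg [] C a b).
- intros a b; apply consequence_rule1; intro C; exact (R_opp [] C a b).
- intros a b c [L [LT h]] [M [MT k]]; exists (L ++ M); split.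
  + intros t tLM; apply in_app_or in tLM as [tL | tM]; auto.
  + apply (provable_rule _ _ (R_cut [] L [] M a b c)); repeat constructor; assumption.
- intros a b [L1 [T1 h1]] [L2 [T2 h2]] [L3 [T3 h3]] [L4 [T4 h4]].
  exists (L1 ++ L2 ++ L3 ++ L4); split.
  + intros t tL; rewrite !in_app_iff in tL; intuition auto.
  + apply (provable_rule _ _ (R_order [] L1 [] L2 [] L3 [] L4 a b));
      repeat constructor; assumption.
- intro a.
  (* If neither case yields a consequence, both components of (Sp) lie in [T], and this axiom
     contradicts refutability. *)
  destruct (Tmax (Sequent a (FMeet a a))) as [h | T1]; [now left|].
  destruct (Tmax (Sequent (FJoin a a) a)) as [h | T2]; [now right|].
  exfalso; apply (Tref _) with (2 := provable_axiom _ (Ax_Sp a)).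
  intros s [<- | [<- | []]]; assumption.
Qed.

Theorem theorem42 (H : hypersequent) : valid H -> provable H.
Proof.
intro hv; apply NNPP; intro nH.
destruct (exists_maximal_refutable H nH) as [T [HT [Tref Tmax]]].
destruct (valid_pure_order _ H (consequence_pure_order T Tref Tmax) hv)
  as [[a b] [sH [L [LT h]]]].
(* A component of [H] is itself in [T], so its being a consequence makes a finite sequence of
   members of [T] provable. *)
apply (Tref (Sequent a b :: L)); [|exact h].
intros t [<- | tL]; [now apply HT | now apply LT].
Qed.
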